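(* Let $f$ and $\tilde f$ be two quadratic vector fields on $\mathbb{R}^n$. If $\ker F_f=\ker F_{\tilde f}$, then Kahan's method applied to the two vector fields has the same preserved measures and first integrals, where the preserved measures and first integrals in question are those obtained by expressing them in terms of aromas.
   Context: **Kahan's method.** A quadratic vector field on $\mathbb{R}^n$ is an $f:\mathbb{R}^n\to\mathbb{R}^n$ whose components are polynomials of degree at most 2. Kahan's method with step size $h$ applied to $\dot x=f(x)$ is the map $\Phi_h(x)=x+h\left(I-\tfrac h2 f'(x)\right)^{-1}f(x)$, where $f'$ is the Jacobian matrix. **Preserved measures and first integrals.** If $P\circ\Phi_h=\det(D\Phi_h)\cdot P$, then $P$ is the reciprocal density of a preserved measure $dx_1\wedge\cdots\wedge dx_n/P$ of $\Phi_h$. The quotient of two such functions $P$ is a first integral of $\Phi_h$. **Aromas.** An aroma is a connected directed graph (self-loops allowed) in which every vertex has exactly one outgoing edge. $\mathcal A$ denotes the set of multisets (disjoint unions) of aromas, including the empty multiset $\mathbf 1$. For $\alpha\in\mathcal A$, $|\alpha|$ is the number of vertices and $\sigma(\alpha)$ is the cardinality of the symmetry group of the graph $\alpha$. **Aromatic functions.** For $\alpha\in\mathcal A$, label the vertices by indices. To a vertex with label $j$, whose incoming edges come from the vertices labelled $i_1,\dots,i_m$, associate $f^j_{i_1\cdots i_m}=\partial^m f^j/\partial x_{i_1}\cdots\partial x_{i_m}$. The function $F_f(\alpha)$ is the product of these factors over all vertices, with every index summed from $1$ to $n$; $F_f(\mathbf 1)=1$. A function is expressed in terms of aromas if it is written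 as an aromatic series $\sum_{\alpha\in\mathcal A}\frac{h^{|\alpha|}\gamma(\alpha)}{\sigma(\alpha)}F_f(\alpha)$ with real coefficients $\gamma(\alpha)$. **Kernel.** Let $\mathbb{R}\langle\mathcal A\rangle$ be the free real vector space on $\mathcal A$ and $\mathbb{R}\langle\mathcal A\rangle^*$ its dual. Then $\ker F_f=\left\{k\in\mathbb{R}\langle\mathcal A\rangle^*:\ \sum_{\alpha\in\mathcal A}\frac{h^{|\alpha|}k(\alpha)}{\sigma(\alpha)}F_f(\alpha)=0\right\}$. It describes the functional dependencies between the derivatives of $f$. *)

(* Defs.v *)
From HB Require Import structures.
From mathcomp Require Import all_boot all_order all_algebra all_fingroup.
From mathcomp Require Import generic_quotient.
From mathcomp Require Import mpoly.
From mathcomp Require Import boolp classical_sets reals.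

Set Implicit Arguments.
Unset Strict Implicit.
Unset Printing Implicit Defensive.

Import GRing.Theory.
Local Open Scope ring_scope.
Local Open Scope quotient_scope.

(* The formal power series A[[h]]: a record, because nat -> A already
   carries the pointwise product. *)
Record fps (A : Type) := Fps { fcoef : nat -> A }.

Section FpsRing.
Variable A : comNzRingType.
Implicit Types p q r : fps A.

Lemma fcoefK : cancel (@fcoef A) (@Fps A). Proof. by case. Qed.

HB.instance Definition _ := Choice.copy (fps A) (can_type fcoefK).

Lemma fpsP p q : (forall k, fcoef p k = fcoef q k) -> p = q.
Proof. by case: p q => [u] [v] /= e; congr Fps; apply: funext. Qed.

Definition fps_add p q := Fps (fun k => fcoef p k + fcoef q k).
Definition fps_opp p := Fps (fun k => - fcoef p k).
Definition fpsC (c : A) := Fps (fun k => if k == 0 then c else 0).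
Definition fpsX : fps A := Fps (fun k => (k == 1)%:R).
Definition fps_mul p q :=
  Fps (fun k => \sum_(i < k.+1) fcoef p i * fcoef q (k - i)).

Fact fps_addA : associative fps_add.
Proof. by move=> p q r; apply: fpsP => k /=; rewrite addrA. Qed.
Fact fps_addC : commutative fps_add.
Proof. by move=> p q; apply: fpsP => k /=; rewrite addrC. Qed.
Fact fps_add0 : left_id (fpsC 0) fps_add.
Proof. by move=> p; apply: fpsP => k /=; rewrite if_same add0r. Qed.
Fact fps_addN : left_inverse (fpsC 0) fps_opp fps_add.
Proof. by move=> p; apply: fpsP => k /=; rewrite if_same addNr. Qed.

HB.instance Definition _ :=
  GRing.isZmodule.Build (fps A) fps_addA fps_addC fps_add0 fps_addN.

Definition fps_trunc N p : {poly A} := \poly_(i < N) fcoef p i.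

Fact fps_mulE N p q k : (k < N)%N ->
  fcoef (fps_mul p q) k = (fps_trunc N p * fps_trunc N q)`_k.
Proof.
move=> ltkN; rewrite coefM /=; apply: eq_bigr => i _; rewrite !coef_poly.
by rewrite (leq_ltn_trans _ ltkN) ?leq_ord // (leq_ltn_trans _ ltkN) ?leq_subr.
Qed.

Fact fps_mulC : commutative fps_mul.
Proof. by move=> p q; apply: fpsP => k; rewrite !(fps_mulE _ _ (ltnSn k)) mulrC. Qed.

Fact fps_mulA : associative fps_mul.
Proof.
move=> p q r; apply: fpsP => k; rewrite !(fps_mulE _ _ (ltnSn k)).
transitivity ((fps_trunc k.+1 p * (fps_trunc k.+1 q * fps_trunc k.+1 r))`_k).
  rewrite !coefM; apply: eq_bigr => i _; congr (_ * _).
  have lti : (k - i < k.+1)%N by rewrite ltnS leq_subr.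
  by rewrite coef_poly lti (fps_mulE _ _ lti).
rewrite mulrA !coefM; apply: eq_bigr => i _; congr (_ * _).
by rewrite coef_poly ltn_ord (fps_mulE _ _ (ltn_ord i)).
Qed.

Fact fps_mul1 : left_id (fpsC 1) fps_mul.
Proof.
move=> p; apply: fpsP => k /=; rewrite big_ord_recl /= mul1r subn0.
by rewrite big1 ?addr0 // => i _; rewrite mul0r.
Qed.

Fact fps_mulDl : left_distributive fps_mul fps_add.
Proof.
move=> p q r; apply: fpsP => k /=; rewrite -big_split /=.
by apply: eq_bigr => i _; rewrite mulrDl.
Qed.

Fact fps_oner_neq0 : fpsC 1 != 0.
Proof.
by apply/eqP => /(congr1 (fun p => fcoef p 0)) /= /eqP; rewrite oner_eq0.
Qed.

HB.instance Definition _ := GRing.Zmodule_isComNzRing.Build (fps A)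
  fps_mulA fps_mulC fps_mul1 fps_mulDl fps_oner_neq0.

Definition fps_unit : {pred fps A} := fun p => `[< exists q, q * p = 1 >].

Definition fps_inv p : fps A :=
  match pselect (exists q, q * p = 1) with
  | left pU => projT1 (cid pU)
  | right _ => p
  end.

Fact fps_mulV : {in fps_unit, left_inverse 1 fps_inv *%R}.
Proof.
move=> p /asboolP pU; rewrite /fps_inv; case: pselect => // pU'.
by case: cid.
Qed.
Fact fps_unitP p q : q * p = 1 -> p \in fps_unit.
Proof. by move=> qp; apply/asboolP; exists q. Qed.
Fact fps_inv_out : {in [predC fps_unit], fps_inv =1 id}.
Proof.
move=> p /= pNU; rewrite /fps_inv; case: pselect => // pU.
by case/negP: pNU; apply/asboolP.
Qed.

HB.instance Definition _ := GRing.ComNzRing_hasMulInverse.Build (fps A)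
  fps_mulV fps_unitP fps_inv_out.

End FpsRing.

(* A finite directed graph with exactly one edge out of every vertex is a
   map g : V -> V on its vertices: the edge out of v goes to g v. *)

Definition graph_iso (V W : finType) (g : V -> V) (g' : W -> W) : Prop :=
  exists2 s : V -> W, bijective s & forall v, s (g v) = g' (s v).

Definition is_aroma (V : finType) (g : V -> V) : Prop :=
  (0 < #|V|)%N /\ forall u v, connect [rel x y | (g x == y) || (g y == x)] u v.

Definition disjoint_union (I : finType) (V : I -> finType)
    (g : forall i, V i -> V i) (v : {i : I & V i}) : {i : I & V i} :=
  Tagged V (g (tag v) (tagged v)).

(* So the disjoint unions of aromas with N vertices are, up to isomorphism,
   the maps from 'I_N to itself. *)
Lemma aroma_decomposition (W : finType) (g : W -> W) :
  exists (I : finType) (V : I -> finType) (gV : forall i, V i -> V i),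
    (forall i, is_aroma (gV i)) /\ graph_iso g (disjoint_union gV).
Proof.
pose e := [rel x y : W | (g x == y) || (g y == x)].
have e_sym : connect_sym e.
  by apply: sym_connect_sym => x y /=; rewrite orbC.
have rg x : fingraph.root e (g x) = fingraph.root e x.
  apply/esym/eqP; rewrite root_connect //; apply: connect1.
  by rewrite /= eqxx.
pose I : finType := {x : W | roots e x}.
pose V (i : I) : finType := {x : W | fingraph.root e x == val i}.
pose gV (i : I) (x : V i) : V i :=
  exist (fun y => fingraph.root e y == val i) (g (val x))
    (introT eqP (etrans (rg (val x)) (eqP (valP x)))).
exists I, V, gV; split=> [i|].
  split.
    by apply/card_gt0P; exists (exist _ (val i) (valP i)).
  suff lift p (u : V i) : path e (val u) p ->
      forall v : V i, last (val u) p = val v ->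
      connect [rel x y : V i | (gV i x == y) || (gV i y == x)] u v.
    move=> u v; have : connect e (val u) (val v).
      by rewrite -root_connect // (eqP (valP u)) (eqP (valP v)).
    by case/connectP => p ep lp; apply: (lift p) => //; rewrite -lp.
  elim: p u => [|y p IHp] u /=.
    by move=> _ v /val_inj ->.
  case/andP=> uy yp v lv.
  have yi : fingraph.root e y == val i.
    by rewrite -(eqP (valP u)) eq_sym root_connect //; apply: connect1.
  pose y' : V i := exist _ y yi.
  apply: (@connect_trans _ _ y'); last exact: IHp.
  by apply: connect1; rewrite /= -!val_eqE /=.
pose mk x r (rr : roots e r) (xr : fingraph.root e x == r) : {i : I & V i} :=
  existT V (exist _ r rr) (exist _ x xr).
have mkE x r r' rr rr' xr xr' : @mk x r rr xr = @mk x r' rr' xr'.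
  have rr'E : r = r' by rewrite -(eqP xr) (eqP xr').
  move: rr xr; rewrite {r}rr'E => rr xr.
  by rewrite (bool_irrelevance rr rr') (bool_irrelevance xr xr').
pose s (x : W) : {i : I & V i} := mk x _ (roots_root e_sym x) (eqxx _).
pose t (v : {i : I & V i}) : W := sval (tagged v).
exists s; last by move=> x; exact: mkE.
exists t => [x //|[[r rr] [x xr]]]; exact: mkE.
Qed.

Definition digraph_iso N (g g' : {ffun 'I_N -> 'I_N}) : bool :=
  [exists s : {perm 'I_N}, [forall v, s (g v) == g' (s v)]].

Lemma digraph_isoP N (g g' : {ffun 'I_N -> 'I_N}) :
  reflect (graph_iso g g') (digraph_iso g g').
Proof.
apply: (iffP existsP) => [[s /forallP es]|[s s_bij es]].
  by exists s => [|v]; [exact: (Bijective (permK s) (permKV s)) | exact/eqP].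
exists (perm (bij_inj s_bij)); apply/forallP => v.
by rewrite !permE es.
Qed.

Fact digraph_iso_equiv N : equiv_class_of (@digraph_iso N).
Proof.
split=> [g | g g' | g2 g1 g3].
- by apply/digraph_isoP; exists id => //; exists id.
- suff sym (a b : {ffun 'I_N -> 'I_N}) : digraph_iso a b -> digraph_iso b a.
    by apply/idP/idP; exact: sym.
  case/digraph_isoP => s [t sK tK] es; apply/digraph_isoP; exists t.
    by exists s.
  by move=> v; apply: (can_inj sK); rewrite tK es tK.
- move=> /digraph_isoP[s s_bij es] /digraph_isoP[t t_bij et].
  apply/digraph_isoP; exists (t \o s); first exact: bij_comp.
  by move=> v /=; rewrite es et.
Qed.

Canonical digraph_iso_equiv_rel N := EquivRelPack (@digraph_iso_equiv N).

(* The multisets of aromas with N vertices in total. *)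
Definition aromas (N : nat) : Type := {eq_quot (digraph_iso_equiv_rel N)}.

HB.instance Definition _ N := EqQuotient.on (aromas N).
HB.instance Definition _ N := Choice.on (aromas N).
HB.instance Definition _ N :=
  Countable.copy (aromas N) (can_type (@reprK _ (aromas N))).
HB.instance Definition _ N : isFinite (aromas N) :=
  CanIsFinite (@reprK _ (aromas N)).

(* The set of all multisets of aromas; |alpha| is tag alpha. *)
Definition multiaroma : Type := {N : nat & aromas N}.

(* No two edges of such a graph are parallel, so its symmetries are
   permutations of the vertices. *)
Definition sigma N (a : aromas N) : nat :=
  #|[set s : {perm 'I_N} | [forall v, s (repr a v) == repr a (s v)]]|.

Section Aromatic.
Variables (R : realType) (n : nat).
Implicit Types (f : 'cV[{mpoly R[n]}]_n) (g : 'cV[fps {mpoly R[n]}]_n).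

(* msize is the total degree plus one. *)
Definition quadratic f : Prop := forall i, (msize (f i 0%R) <= 3)%N.

(* The multinomial attached to v records the labels of the predecessors
   of v; the result does not depend on the representative. *)
Definition aromatic_fun f N (a : aromas N) : {mpoly R[n]} :=
  \sum_(l : {ffun 'I_N -> 'I_n})
    \prod_(v : 'I_N) (f (l v) 0)^`M[(\sum_(u | repr a u == v) U_(l u))%MM].

(* The dual of the free vector space on the multisets of aromas. *)
Definition aroma_dual : Type := multiaroma -> R.

Definition aromatic_series f (gamma : aroma_dual) : fps {mpoly R[n]} :=
  Fps (fun N => \sum_(a : aromas N)
    (gamma (Tagged aromas a) / (sigma a)%:R) *: aromatic_fun f a).

Definition kerF f : set aroma_dual := [set k | aromatic_series f k = 0].

Definition jacobian f : 'M[{mpoly R[n]}]_n := \matrix_(i, j) (f i 0)^`M(j).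

(* The Kahan map is rational in (x, h) and regular at h = 0; it is taken
   with the step size h as an indeterminate, as a vector over R[x][[h]],
   where I - h/2 f'(x) is invertible. *)
Definition kahan f : 'cV[fps {mpoly R[n]}]_n :=
  let const := @fpsC {mpoly R[n]} in
  map_mx const (\col_i 'X_i) +
  fpsX _ *: (invmx (1%:M - (fpsX _ * const (2^-1)%:MP)
                            *: map_mx const (jacobian f))
             *m map_mx const f).

Definition fps_jacobian g : 'M[fps {mpoly R[n]}]_n :=
  \matrix_(i, j) Fps (fun k => (fcoef (g i 0%R) k)^`M(j)).

(* P(g(x)): if P = sum_k h^k P_k(x), this is sum_k h^k P_k(g(x)). *)
Definition fps_comp (P : fps {mpoly R[n]}) g : fps {mpoly R[n]} :=
  Fps (fun N => \sum_(k < N.+1)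
    fcoef (mmap (fun c : R => fpsC c%:MP) (fun i => g i 0) (fcoef P k)) (N - k)).

(* P is the reciprocal density of a measure dx_1 /\ ... /\ dx_n / P
   preserved by g. *)
Definition preserves_measure g (P : fps {mpoly R[n]}) : Prop :=
  P <> 0 /\ fps_comp P g = \det (fps_jacobian g) * P.

(* P / Q is invariant under g; the equality of the fractions P(g) / Q(g)
   and P / Q is cross-multiplied. *)
Definition first_integral g (P Q : fps {mpoly R[n]}) : Prop :=
  Q <> 0 /\ fps_comp P g * Q = P * fps_comp Q g.

End Aromatic.

(* Main.v *)
Require Import Defs.
From HB Require Import structures.
From mathcomp Require Import all_boot all_order all_algebra all_fingroup.
From mathcomp Require Import generic_quotient.
From mathcomp Require Import mpoly.
From mathcomp Require Import boolp classical_sets reals ring.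

(* Call a series in h universal if its h^N coefficient is, with coefficients not
   depending on f, a linear combination of the aromatic functions of the graphs
   with N vertices. A universal series is an aromatic series in f, so whether it
   vanishes at f depends only on ker F_f. It is therefore enough to write both
   conditions as the vanishing of universal series.

   Universal series are closed under products (disjoint unions of graphs) and
   under composition with the Kahan map x + u: Taylor expansion at x grafts
   leaves carrying u onto the vertices, and u = h f + (h/2) f' u replaces a leaf
   by an ordinary vertex with at most one leaf above it, at the price of a factor
   h. This settles first integrals.

   For measures, differentiating (1 - h f'/2) u = h f gives, for quadratic f,
   (1 - h f'/2) DPhi = 1 + (h/2) f'(Phi), so that, with p_c = det(1 + c h f'),
   p_(-1/2) det(DPhi) is the composition of p_(1/2) with Phi. Finally p_c is
   universal: Jacobi's formula expresses its coefficients recursively by the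
   traces tr f'^k, which are the aromatic functions of cycles. *)

Set Implicit Arguments.
Unset Strict Implicit.
Unset Printing Implicit Defensive.

Import GRing.Theory Num.Theory.
Local Open Scope ring_scope.

(** * Sums over labelled graphs *)

Section BigOption.
Variables (B : Type) (idx : B) (op : Monoid.com_law idx).

Lemma big_option (X : finType) (P : pred (option X)) (F : option X -> B) :
  \big[op/idx]_(u | P u) F u =
  op (if P None then F None else idx) (\big[op/idx]_(u | P (Some u)) F (Some u)).
Proof.
rewrite [in LHS]big_mkcond (bigD1 None) //=; congr (op _ _).
rewrite [in RHS]big_mkcond /= (reindex_omap Some id) /=; last by case.
by apply: eq_bigl => u; rewrite eqxx.
Qed.

Lemma big_ffun_option (X T : finType) (F : {ffun option X -> T} -> B) :
  \big[op/idx]_l F l =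
  \big[op/idx]_(l : {ffun X -> T}) \big[op/idx]_(j : T) F [ffun u => oapp l j u].
Proof.
rewrite pair_bigA /= (reindex (fun p : {ffun X -> T} * T =>
  [ffun u : option X => oapp p.1 p.2 u])) //=.
exists (fun l : {ffun option X -> T} => ([ffun u => l (Some u)], l None)).
  by move=> [l j] _ /=; rewrite ffunE /=; congr pair; apply/ffunP => u; rewrite !ffunE.
by move=> l _; apply/ffunP => -[u|]; rewrite !ffunE //= ffunE.
Qed.

Lemma big_ffun_sum (X Y T : finType) (F : {ffun X + Y -> T} -> B) :
  \big[op/idx]_l F l =
  \big[op/idx]_(l : {ffun X -> T}) \big[op/idx]_(k : {ffun Y -> T})
     F [ffun u => match u with inl x => l x | inr y => k y end].
Proof.
rewrite pair_bigA /= (reindex (fun p : {ffun X -> T} * {ffun Y -> T} =>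
  [ffun u : X + Y => match u with inl x => p.1 x | inr y => p.2 y end])) //=.
exists (fun l : {ffun X + Y -> T} => ([ffun u => l (inl u)], [ffun u => l (inr u)])).
  by move=> [l k] _ /=; congr pair; apply/ffunP => u; rewrite !ffunE.
by move=> l _; apply/ffunP => -[u|u]; rewrite !ffunE.
Qed.

End BigOption.

Section Net.
Variables (B : comNzRingType) (n : nat).

Definition in_labels (X : finType) (g : X -> X) (l : {ffun X -> 'I_n}) (v : X) :
  'X_{1..n} := (\sum_(u | g u == v) U_(l u))%MM.

(* An aromatic function in which every vertex v carries its own value K v i m,
   depending on the label i of v and on the multiset m of the labels of its
   predecessors; the value of an ordinary vertex is the m-th derivative of f^i. *)
Definition net (X : finType) (K : X -> 'I_n -> 'X_{1..n} -> B) (g : X -> X) : B :=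
  \sum_(l : {ffun X -> 'I_n}) \prod_v K v (l v) (in_labels g l v).

Lemma eq_net (X : finType) (K K' : X -> 'I_n -> 'X_{1..n} -> B) (g g' : X -> X) :
  (forall v i m, K v i m = K' v i m) -> g =1 g' -> net K g = net K' g'.
Proof.
move=> eK eg; apply: eq_bigr => l _; apply: eq_bigr => v _; rewrite eK.
by congr K'; apply: eq_bigl => u; rewrite eg.
Qed.

Lemma net_iso (X Y : finType) (s : X -> Y) K (g : X -> X) (g' : Y -> Y) :
  bijective s -> (forall v, s (g v) = g' (s v)) ->
  net (fun v => K (s v)) g = net K g'.
Proof.
move=> [t sK tK] sg; rewrite /net.
rewrite (reindex (fun l : {ffun Y -> 'I_n} => [ffun v => l (s v)])) /=; last first.
  exists (fun l : {ffun X -> 'I_n} => [ffun v => l (t v)]) => l _;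
  by apply/ffunP => v; rewrite !ffunE ?sK ?tK.
apply: eq_bigr => l _; rewrite [RHS](reindex s) /=; last by exists t.
apply: eq_bigr => v _; rewrite ffunE; congr K.
rewrite /in_labels [RHS](reindex s) /=; last by exists t.
by apply: eq_big => [u|u _]; rewrite ?ffunE // -sg (can_eq sK).
Qed.

Lemma net_option (X : finType) K (g : option X -> option X) :
  net K g = \sum_(l : {ffun X -> 'I_n}) \sum_(j : 'I_n)
    K None j (in_labels g [ffun u => oapp l j u] None) *
    \prod_v K (Some v) (l v) (in_labels g [ffun u => oapp l j u] (Some v)).
Proof.
rewrite /net big_ffun_option; apply: eq_bigr => l _; apply: eq_bigr => j _.
rewrite big_option /= ffunE; congr (_ * _).
by apply: eq_bigr => v _; rewrite ffunE.
Qed.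

Lemma in_labels_option (X : finType) (g : option X -> option X)
    (l : {ffun X -> 'I_n}) j w :
  in_labels g [ffun u => oapp l j u] w =
  ((if g None == w then U_(j) else 0) + \sum_(u | g (Some u) == w) U_(l u))%MM.
Proof.
rewrite /in_labels big_option ffunE /=; congr (_ + _)%MM.
by apply: eq_bigr => u _; rewrite ffunE.
Qed.

Definition graft (X : finType) (g : X -> X) (v : X) (u : option X) : option X :=
  Some (oapp g v u).

Definition net_color (X : finType) (C : Type) (K : X -> C) (c : C) (u : option X) :=
  oapp K c u.

Definition recolor (X : finType) (C : Type) (K : X -> C) (v : X) (c : C) (u : X) :=
  if u == v then c else K u.

(** The label j of the new leaf occurs only in its own value and in the multiset attached to [v], so
    summing over j first turns [K v] into its directional derivative along [k]. *)
Lemma net_graft (X : finType) K k (g : X -> X) v :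
  net (net_color K k) (graft g v) =
  net (recolor K v (fun i m => \sum_j k j 0%MM * K v i (m + U_(j))%MM)) g.
Proof.
rewrite net_option; apply: eq_bigr => l _.
rewrite [RHS](bigD1 v) //= /recolor eqxx big_distrl /=; apply: eq_bigr => j _.
rewrite in_labels_option /graft /= big_pred0 // addm0 -mulrA; congr (_ * _).
rewrite (bigD1 v) //= in_labels_option /= eqxx addmC; congr (_ * _).
apply: eq_bigr => u ne_uv; rewrite in_labels_option /= (negPf ne_uv).
by rewrite (inj_eq Some_inj) eq_sym (negPf ne_uv) add0m.
Qed.

(* The new vertex is inserted on top of v: it takes all the predecessors of v
   and becomes the only one. *)
Definition insert (X : finType) (g : X -> X) (v : X) (u : option X) : option X :=
  if u is Some u' then if g u' == v then None else Some (g u') else Some v.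

(** The old predecessors of [v] now feed the new vertex, and [v] only sees the label j of that
    vertex; summing over j composes the two values like a matrix product. Iterated insertion
    produces the cycles behind the traces of powers of f'. *)
Lemma net_insert (X : finType) K k (g : X -> X) v :
  net (net_color K k) (insert g v) =
  net (recolor K v (fun i m => \sum_j k j m * K v i U_(j)%MM)) g.
Proof.
rewrite net_option; apply: eq_bigr => l _.
rewrite [RHS](bigD1 v) //= /recolor eqxx big_distrl /=; apply: eq_bigr => j _.
rewrite in_labels_option /= add0m -mulrA; congr (k j _ * _).
  by rewrite /in_labels; apply: eq_bigl => u; case: (g u == v).
rewrite (bigD1 v) //= in_labels_option /= eqxx big_pred0 ?addm0; last first.
  by move=> u; case: (boolP (g u == v)) => // /negPf ne; rewrite (inj_eq Some_inj).
congr (_ * _); apply: eq_bigr => u ne_uv; rewrite in_labels_option /= (negPf ne_uv).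
rewrite (inj_eq Some_inj) eq_sym (negPf ne_uv) add0m; congr K; rewrite /in_labels.
apply: eq_bigl => w; case: (g w =P v) => [->|_]; last by rewrite (inj_eq Some_inj).
by rewrite (eq_sym v) (negPf ne_uv).
Qed.

(** The values are compared only at multisets that [g] produces at [v]. This matters for
    displacement leaves, whose recursion agrees with their value at the empty multiset only. *)
Lemma net_recolor (X : finType) (K : X -> 'I_n -> 'X_{1..n} -> B) k (g : X -> X) v :
  (forall l : {ffun X -> 'I_n},
     K v (l v) (in_labels g l v) = k (l v) (in_labels g l v)) ->
  net K g = net (recolor K v k) g.
Proof.
move=> eK; apply: eq_bigr => l _; apply: eq_bigr => u _; rewrite /recolor.
by case: eqP => // ->.
Qed.

(** Each product contains the value at [v] exactly once, so a net is linear in it. *)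
Lemma net_recolorD (X : finType) (K : X -> 'I_n -> 'X_{1..n} -> B) a b k1 k2
    (g : X -> X) v :
  net (recolor K v (fun i m => a * k1 i m + b * k2 i m)) g =
  a * net (recolor K v k1) g + b * net (recolor K v k2) g.
Proof.
rewrite !big_distrr -big_split; apply: eq_bigr => l _ /=.
rewrite (bigD1 v) //= [X in _ = _ * X + _](bigD1 v) //=.
rewrite [X in _ = _ + _ * X](bigD1 v) //= /recolor eqxx mulrDl !mulrA.
by congr (_ * _ + _ * _); apply: eq_bigr => u /negPf ->.
Qed.

Lemma net_mul (X Y : finType) K K' (g : X -> X) (g' : Y -> Y) :
  net K g * net K' g' =
  net (fun u => match u with inl x => K x | inr y => K' y end)
    (fun u => match u with inl x => inl (g x) | inr y => inr (g' y) end).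
Proof.
rewrite [RHS]/net big_ffun_sum big_distrl; apply: eq_bigr => l _.
rewrite big_distrr; apply: eq_bigr => k _ /=.
rewrite big_sumType /=; congr (_ * _); apply: eq_bigr => v _; rewrite ffunE.
  congr K; rewrite /in_labels big_sumType /= [X in (_ + X)%MM]big_pred0 // addm0.
  by apply: eq_bigr => u _; rewrite ffunE.
congr K'; rewrite /in_labels big_sumType /= [X in (X + _)%MM]big_pred0 // add0m.
by apply: eq_bigr => u _; rewrite ffunE.
Qed.

End Net.

(** * Universal combinations of aromatic functions *)

Section Universal.
Variables (R : realType) (n : nat).
Local Notation field := 'cV[{mpoly R[n]}]_n.
Implicit Types (f : field) (N : nat).

Definition field_jet f (i : 'I_n) (m : 'X_{1..n}) : {mpoly R[n]} := (f i 0)^`M[m].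

Definition graph_fun (X : finType) (g : X -> X) f : {mpoly R[n]} :=
  net (fun _ => field_jet f) g.

(** The combination runs over labelled maps rather than isomorphism classes, so that no
    representatives have to be chosen; [c] is fixed before [f]. *)
Definition universal N (S : field -> {mpoly R[n]}) : Prop :=
  exists c : {ffun 'I_N -> 'I_N} -> R,
    forall f, quadratic f -> S f = \sum_g c g *: graph_fun g f.

Lemma eq_universal N S T :
  (forall f, quadratic f -> S f = T f) -> universal N T -> universal N S.
Proof. by move=> eST [c cT]; exists c => f qf; rewrite eST ?cT. Qed.

Lemma universal0 N : universal N (fun=> 0).
Proof. by exists (fun=> 0) => f _; rewrite big1 // => g _; rewrite scale0r. Qed.

Lemma universalD N S T :
  universal N S -> universal N T -> universal N (fun f => S f + T f).
Proof.
move=> [c cS] [d dT]; exists (fun g => c g + d g) => f qf.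
by rewrite cS ?dT // -big_split; apply: eq_bigr => g _; rewrite scalerDl.
Qed.

Lemma universalZ N a S : universal N S -> universal N (fun f => a *: S f).
Proof.
move=> [c cS]; exists (fun g => a * c g) => f qf.
by rewrite cS // scaler_sumr; apply: eq_bigr => g _; rewrite scalerA.
Qed.

Lemma universal_sum N (I : Type) (r : seq I) (P : pred I) S :
  (forall i, P i -> universal N (S i)) ->
  universal N (fun f => \sum_(i <- r | P i) S i f).
Proof.
move=> uS; elim: r => [|i r IHr].
  by apply: eq_universal (universal0 N) => f _; rewrite big_nil.
have [Pi|NPi] := boolP (P i).
  by apply: eq_universal (universalD (uS i Pi) IHr) => f _; rewrite big_cons Pi.
by apply: eq_universal IHr => f _; rewrite big_cons (negPf NPi).
Qed.

(** Transport along an enumeration of the vertices; grafting, insertion and disjoint union yield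
    vertex types such as [option X] and [X + Y]. *)
Lemma universal_graph N (X : finType) (g : X -> X) :
  #|X| = N -> universal N (graph_fun g).
Proof.
move=> <-; pose g' := [ffun i : 'I_#|X| => enum_rank (g (enum_val i))].
exists (fun h => (h == g')%:R) => f _.
rewrite (bigD1 g') //= eqxx scale1r big1 => [|h /negPf->]; last by rewrite scale0r.
rewrite addr0; apply: (@net_iso _ _ _ _ enum_rank).
  by exists enum_val; [exact: enum_rankK | exact: enum_valK].
by move=> v; rewrite ffunE enum_rankK.
Qed.

Lemma universalM N M S T :
  universal N S -> universal M T -> universal (N + M) (fun f => S f * T f).
Proof.
move=> [c cS] [d dT].
have uM (g : {ffun 'I_N -> 'I_N}) (h : {ffun 'I_M -> 'I_M}) :
    universal (N + M) (fun f => graph_fun g f * graph_fun h f).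
  have card_NM : #|{: 'I_N + 'I_M}| = (N + M)%N by rewrite card_sum !card_ord.
  apply: eq_universal (universal_graph _ card_NM) => f _.
  by rewrite /graph_fun net_mul; apply: eq_net => [[] |].
have u := universal_sum (index_enum _) (P := xpredT) (fun g _ =>
  universal_sum (index_enum _) (P := xpredT) (fun h _ =>
  universalZ (c g * d h) (uM g h))).
apply: eq_universal u => f qf; rewrite cS // dT // big_distrlr /=.
by do 2![apply: eq_bigr => ? _]; rewrite -scalerAl -scalerAr scalerA.
Qed.

Definition universal_series (S : field -> fps {mpoly R[n]}) : Prop :=
  forall N, universal N (fun f => fcoef (S f) N).

Lemma universal_seriesB S T :
  universal_series S -> universal_series T -> universal_series (fun f => S f - T f).
Proof.
move=> uS uT N; apply: eq_universal (universalD (uS N) (universalZ (-1) (uT N))).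
by move=> f _; rewrite scaleN1r.
Qed.

Lemma universal_seriesM S T :
  universal_series S -> universal_series T -> universal_series (fun f => S f * T f).
Proof.
move=> uS uT N /=; apply: universal_sum => i _.
by rewrite -{1}(subnKC (leq_ord i)); exact: universalM.
Qed.

Lemma aromatic_series_universal (gamma : aroma_dual R) :
  universal_series (fun f => aromatic_series f gamma).
Proof.
move=> N /=; apply: universal_sum => a _; apply: universalZ.
exact: (universal_graph (repr a) (card_ord N)).
Qed.

Lemma sigma_gt0 N (a : aromas N) : (0 < sigma a)%N.
Proof.
by apply/card_gt0P; exists 1%g; rewrite inE; apply/forallP => v; rewrite !perm1.
Qed.

Lemma graph_fun_aromatic N (g : {ffun 'I_N -> 'I_N}) f :
  graph_fun g f = aromatic_fun f (\pi_(aromas N) g)%qT.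
Proof.
have /eqmodP/digraph_isoP[s s_bij sg] : (g = repr (\pi_(aromas N) g) %[mod aromas N])%qT.
  by rewrite reprK.
exact: (net_iso (fun _ => field_jet f) s_bij sg).
Qed.

(** The coefficients of all labelled maps in one isomorphism class are added up; the factor [sigma]
    cancels the division built into aromatic series. *)
Lemma universal_aromatic_series S : universal_series S ->
  exists gamma : aroma_dual R,
    forall f, quadratic f -> S f = aromatic_series f gamma.
Proof.
move=> uS; pose c N := projT1 (cid (uS N)).
have cS N : forall f, quadratic f -> fcoef (S f) N = \sum_g c N g *: graph_fun g f :=
  projT2 (cid (uS N)).
exists (fun a => (sigma (tagged a))%:R *
  \sum_(g | (\pi_(aromas (tag a)) g)%qT == tagged a) c (tag a) g).
move=> f qf; apply: fpsP => N; rewrite cS //=.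
rewrite (partition_big (fun g => (\pi_(aromas N) g)%qT) xpredT) //=.
apply: eq_bigr => a _; rewrite mulrAC divff ?mul1r; last first.
  by rewrite pnatr_eq0 -lt0n sigma_gt0.
by rewrite scaler_suml; apply: eq_bigr => g /eqP<-; rewrite graph_fun_aromatic.
Qed.

(** The same [gamma] represents S at both fields, and vanishing at a field is membership of [gamma]
    in its kernel. *)
Lemma universal_eq0 S f ft : universal_series S ->
  quadratic f -> quadratic ft -> kerF f = kerF ft -> S f = 0 <-> S ft = 0.
Proof.
move=> /universal_aromatic_series[gamma Sg] qf qft eq_ker.
rewrite !Sg // -[_ = 0]/(kerF f gamma) eq_ker; exact: iff_refl.
Qed.

End Universal.

(** * Formal power series *)

Section FpsTheory.
Variable A : comNzRingType.
Implicit Types (p q t : fps A) (N k : nat).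

Lemma fcoefD p q N : fcoef (p + q) N = fcoef p N + fcoef q N. Proof. by []. Qed.

Lemma fcoefN p N : fcoef (- p) N = - fcoef p N. Proof. by []. Qed.

Lemma fcoefM p q N : fcoef (p * q) N = \sum_(i < N.+1) fcoef p i * fcoef q (N - i).
Proof. by []. Qed.

Lemma fcoef0 N : fcoef (0 : fps A) N = 0. Proof. by rewrite /= if_same. Qed.

Lemma fcoef_sum (I : Type) (r : seq I) (P : pred I) (F : I -> fps A) N :
  fcoef (\sum_(i <- r | P i) F i) N = \sum_(i <- r | P i) fcoef (F i) N.
Proof. by apply: (big_morph (fun p => fcoef p N)) => //; exact: fcoef0. Qed.

Lemma fcoefCM a p N : fcoef (fpsC a * p) N = a * fcoef p N.
Proof.
by rewrite fcoefM big_ord_recl subn0 big1 ?addr0 // => i _; rewrite mul0r.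
Qed.

Lemma fcoefXM p N : fcoef (fpsX A * p) N = if N is k.+1 then fcoef p k else 0.
Proof.
rewrite fcoefM; case: N => [|N]; first by rewrite big_ord_recl big_ord0 /= mul0r addr0.
rewrite 2!big_ord_recl /= mul0r add0r mul1r subSS subn0 big1 ?addr0 // => i _.
by rewrite mul0r.
Qed.

Lemma fcoefXnM p k N :
  fcoef (fpsX A ^+ k * p) N = if (k <= N)%N then fcoef p (N - k) else 0.
Proof.
elim: k N => [|k IHk] N; first by rewrite mul1r subn0.
by rewrite exprS -mulrA fcoefXM; case: N => // N; rewrite IHk.
Qed.

Fact fpsC_additive : {morph @fpsC A : a b / a - b}.
Proof. by move=> a b; apply: fpsP => N /=; case: eqP; rewrite ?subr0. Qed.
HB.instance Definition _ := GRing.isZmodMorphism.Build A (fps A) (@fpsC A) fpsC_additive.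

Fact fpsC_multiplicative : monoid_morphism (@fpsC A).
Proof.
split=> // a b; apply: fpsP => N; rewrite fcoefCM /=.
by case: eqP; rewrite ?mulr0.
Qed.
HB.instance Definition _ :=
  GRing.isMonoidMorphism.Build A (fps A) (@fpsC A) fpsC_multiplicative.

Definition fps_eval0 p := fcoef p 0.

Fact fps_eval0_additive : {morph fps_eval0 : p q / p - q}. Proof. by []. Qed.
HB.instance Definition _ :=
  GRing.isZmodMorphism.Build (fps A) A fps_eval0 fps_eval0_additive.

Fact fps_eval0_multiplicative : monoid_morphism fps_eval0.
Proof. by split=> // p q; rewrite /fps_eval0 fcoefM big_ord_recl big_ord0 addr0. Qed.
HB.instance Definition _ :=
  GRing.isMonoidMorphism.Build (fps A) A fps_eval0 fps_eval0_multiplicative.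

Lemma fcoef_expr_lt t N k : fcoef t 0 = 0 -> (N < k)%N -> fcoef (t ^+ k) N = 0.
Proof.
move=> t0; elim: k N => // k IHk N ltNk; rewrite exprS fcoefM big_ord_recl t0 mul0r.
rewrite add0r big1 // => i _; rewrite IHk ?mulr0 //.
rewrite ltnS in ltNk; apply: leq_trans ltNk.
by rewrite lift0 ltn_subrL /= (leq_ltn_trans _ (ltn_ord i)).
Qed.

(* The inverse of 1 - t is the geometric series in t. *)
Lemma fps_unit1 p : fcoef p 0 = 1 -> p \is a GRing.unit.
Proof.
move=> p0; pose t := 1 - p.
have t0 : fcoef t 0 = 0 by rewrite fcoefD fcoefN p0 subrr.
pose S M := \sum_(k < M) t ^+ k.
have pS M : p * S M = 1 - t ^+ M.
  by rewrite -[RHS]opprB subrX1 -mulNr opprB /t opprB addrCA subrr addr0.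
(* Powers t^k with k > N do not reach h^N, so the coefficient of h^N is the same in all partial sums
   with more than N terms. *)
have stab M N : (N < M)%N -> fcoef (S M) N = fcoef (S N.+1) N.
  move=> ltNM; rewrite -(subnKC ltNM) /S big_split_ord fcoefD.
  rewrite [X in _ + X]fcoef_sum [X in _ + X]big1 ?addr0 // => k _.
  by rewrite fcoef_expr_lt //= ltnS leq_addr.
apply/unitrPr; exists (Fps (fun N => fcoef (S N.+1) N)); apply: fpsP => N.
rewrite fcoefM /= -/(S _).
transitivity (fcoef (p * S N.+1) N).
  rewrite fcoefM; apply: eq_bigr => i _ /=.
  by rewrite (stab N.+1) // ltnS leq_subr.
by rewrite pS fcoefD fcoefN fcoef_expr_lt // subr0.
Qed.

(** det(1 + c h f') is polynomial in h; through this embedding it can be handled in [{poly A}],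
    where evaluation and the formal derivative are available. *)
Definition fps_of_poly (q : {poly A}) : fps A := Fps (fun N => q`_N).

Fact fps_of_poly_additive : {morph fps_of_poly : p q / p - q}.
Proof. by move=> p q; apply: fpsP => N; rewrite /= coefB. Qed.
HB.instance Definition _ :=
  GRing.isZmodMorphism.Build {poly A} (fps A) fps_of_poly fps_of_poly_additive.

Fact fps_of_poly_multiplicative : monoid_morphism fps_of_poly.
Proof.
split=> [|p q]; apply: fpsP => N; first by rewrite /= coef1; case: eqP.
by rewrite fcoefM /= coefM.
Qed.
HB.instance Definition _ :=
  GRing.isMonoidMorphism.Build {poly A} (fps A) fps_of_poly fps_of_poly_multiplicative.

Lemma fps_of_polyC a : fps_of_poly a%:P = fpsC a.
Proof. by apply: fpsP => N /=; rewrite coefC. Qed.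

Lemma fps_of_polyX : fps_of_poly 'X = fpsX A.
Proof. by apply: fpsP => N /=; rewrite coefX. Qed.

End FpsTheory.

(** * Differentiation and substitution in power series with polynomial coefficients *)

Section FpsMpoly.
Variables (R : realType) (n : nat).
Local Notation A := {mpoly R[n]}.
Local Notation C := (@fpsC A).
Implicit Types (p q : fps A).

Definition fps_deriv (j : 'I_n) p := Fps (fun N => (fcoef p N)^`M(j)).

Lemma fps_derivD j : {morph fps_deriv j : p q / p + q}.
Proof. by move=> p q; apply: fpsP => N /=; rewrite mderivD. Qed.

Lemma fps_deriv0 j : fps_deriv j 0 = 0.
Proof. by apply: fpsP => N /=; rewrite if_same mderiv0. Qed.

Lemma fps_derivC j a : fps_deriv j (C a) = C a^`M(j).
Proof. by apply: fpsP => N /=; case: eqP; rewrite ?mderiv0. Qed.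

Lemma fps_deriv_sum j (I : Type) (r : seq I) (P : pred I) F :
  fps_deriv j (\sum_(i <- r | P i) F i) = \sum_(i <- r | P i) fps_deriv j (F i).
Proof. exact: (big_morph _ (fps_derivD j) (fps_deriv0 j)). Qed.

Lemma fps_derivM j p q : fps_deriv j (p * q) = fps_deriv j p * q + p * fps_deriv j q.
Proof.
apply: fpsP => N; rewrite fcoefD !fcoefM /= (raddf_sum (mderiv j)) -big_split /=.
by apply: eq_bigr => i _; rewrite mderivM.
Qed.

Lemma fps_derivX j : fps_deriv j (fpsX A) = 0.
Proof.
by apply: fpsP => N /=; rewrite if_same -mpolyC_nat mderivC.
Qed.

Definition fps_const (c : R) : fps A := C c%:MP.

HB.instance Definition _ := GRing.RMorphism.copy fps_const (C \o @mpolyC n R).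

Definition fps_subst (g : 'cV[fps A]_n) : A -> fps A :=
  mmap fps_const (fun i => g i 0).

HB.instance Definition _ g :=
  GRing.RMorphism.copy (fps_subst g) (mmap fps_const (fun i => g i 0)).

Lemma fps_substC g c : fps_subst g c%:MP = fps_const c.
Proof. exact: mmapC. Qed.

Lemma fps_substX g i : fps_subst g 'X_i = g i 0.
Proof. by rewrite /fps_subst mmapX mmap1U. Qed.

Lemma fps_substZ g c a : fps_subst g (c *: a) = fps_const c * fps_subst g a.
Proof. by rewrite -mul_mpolyC rmorphM /= fps_substC. Qed.

Lemma fps_compE P g N : fcoef (fps_comp P g) N =
  \sum_(k < N.+1) fcoef (fps_subst g (fcoef P k)) (N - k).
Proof. by []. Qed.

(** For a polynomial in h, composition is substitution in the coefficients followed by evaluation at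
    h. Both are ring morphisms, hence commute with determinants. *)
Lemma fps_comp_poly (q : {poly A}) g :
  fps_comp (fps_of_poly q) g = (map_poly (fps_subst g) q).[fpsX A].
Proof.
apply: fpsP => N; rewrite fps_compE /=.
(* Both sums are padded with zeros to a common range: one stops at N, the other at the size of
   [q]. *)
rewrite (@horner_coef_wide _ (maxn N.+1 (size q))); last first.
  by rewrite (leq_trans (size_poly _ _)) // leq_maxr.
rewrite fcoef_sum (big_ord_widen (maxn N.+1 (size q))
  (fun k => fcoef (fps_subst g q`_k) (N - k))) ?leq_maxl // big_mkcond.
apply: eq_bigr => k _; rewrite coef_map mulrC fcoefXnM.
by rewrite ltnS.
Qed.

End FpsMpoly.

(** * Taylor expansion of quadratic polynomials *)

Section Kahan.
Variables (R : realType) (n : nat).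
Local Notation A := {mpoly R[n]}.
Local Notation C := (@fpsC A).
Local Notation X := (fpsX A).
Local Notation field := 'cV[A]_n.
Implicit Types (f : field) (p q : A) (N : nat).

Lemma msize_mderiv p k i : (msize p <= k.+1)%N -> (msize p^`M(i) <= k)%N.
Proof.
move=> le_pk; rewrite msizeE; apply/bigmax_leqP_seq => m.
rewrite mcoeff_msupp mcoeff_deriv => nz _.
have : (m + U_(i))%MM \in msupp p.
  by rewrite mcoeff_msupp; apply: contraNneq nz => ->; rewrite mul0rn.
by move/msize_mdeg_lt; rewrite mdegD mdeg1 addn1 => /leq_trans/(_ le_pk).
Qed.

Lemma msize_mderivm p k m : (msize p <= k)%N -> (msize p^`M[m] <= k)%N.
Proof.
have msize_d q i : (msize q <= k)%N -> (msize q^`M(i) <= k)%N.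
  by move=> le_qk; apply: msize_mderiv; exact: leqW.
move=> le_pk; rewrite /mderivm; elim: (enum 'I_n) => //= i s IHs.
by elim: (m i) => //= d; exact: msize_d.
Qed.

(** First and second differentials of p along u, with the entries of u treated as constants; [dir2]
    does not include the Taylor factor 1/2. *)
Definition dir1 (u : 'I_n -> fps A) p : fps A := \sum_j u j * C p^`M(j).
Definition dir2 (u : 'I_n -> fps A) p : fps A :=
  \sum_j u j * \sum_k u k * C p^`M(j)^`M(k).

Lemma dir1M u p q : dir1 u (p * q) = dir1 u p * C q + C p * dir1 u q.
Proof.
rewrite big_distrl big_distrr -big_split; apply: eq_bigr => j _ /=.
by rewrite mderivM rmorphD !rmorphM /=; ring.
Qed.

Lemma dir2M u p q :
  dir2 u (p * q) = dir2 u p * C q + dir1 u p * dir1 u q *+ 2 + C p * dir2 u q.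
Proof.
rewrite mulr2n {1}[dir1 u p * dir1 u q]mulrC {1 3}/dir1 !big_distrl big_distrr.
rewrite -!big_split; apply: eq_bigr => j _ /=.
rewrite -[X in X + _ + _]mulrA -[X in _ + (X + _) + _]mulrA -[X in _ + (_ + X) + _]mulrA.
rewrite [X in _ + X]mulrCA -!mulrDr; congr (_ * _).
rewrite /dir1 !big_distrl !big_distrr -!big_split /=; apply: eq_bigr => k _ /=.
by rewrite mderivM mderivD !mderivM !rmorphD !rmorphM /=; ring.
Qed.

Lemma mderivU i j : ('X_i : A)^`M(j) = (i == j)%:R%:MP.
Proof.
rewrite mderivX mnm1E; case: eqP => [->|_]; last by rewrite scale0r mpolyC0.
by rewrite scale1r -[X in (X - _)%MM]add0m addmK mpolyX0 mpolyC1.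
Qed.

Lemma dir1X u i : dir1 u 'X_i = u i.
Proof.
rewrite /dir1 (bigD1 i) //= big1 ?addr0 => [|j ne_ji].
  by rewrite mderivU eqxx mpolyC1 rmorph1 mulr1.
by rewrite mderivU eq_sym (negPf ne_ji) mpolyC0 rmorph0 mulr0.
Qed.

Lemma dir2X u i : dir2 u 'X_i = 0.
Proof.
rewrite /dir2 big1 // => j _; rewrite big1 ?mulr0 // => k _.
by rewrite mderivU mderivC rmorph0 mulr0.
Qed.

Lemma dir1D u : {morph dir1 u : p q / p + q}.
Proof.
move=> p q; rewrite -big_split; apply: eq_bigr => j _.
by rewrite mderivD rmorphD mulrDr.
Qed.

Lemma dir2D u : {morph dir2 u : p q / p + q}.
Proof.
move=> p q; rewrite -big_split; apply: eq_bigr => j _.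
rewrite /= -mulrDr -big_split; congr (_ * _); apply: eq_bigr => k _.
by rewrite !mderivD rmorphD mulrDr.
Qed.

Lemma dir1C u c : dir1 u c%:MP = 0.
Proof. by rewrite /dir1 big1 // => j _; rewrite mderivC rmorph0 mulr0. Qed.

Lemma dir2C u c : dir2 u c%:MP = 0.
Proof.
rewrite /dir2 big1 // => j _; rewrite big1 ?mulr0 // => k _.
by rewrite mderivC mderiv0 rmorph0 mulr0.
Qed.

Lemma quadratic_mpoly_ind (P : A -> Prop) :
  (forall p q, P p -> P q -> P (p + q)) -> (forall c p, P p -> P (c%:MP * p)) ->
  P 1 -> (forall i, P 'X_i) -> (forall i j, P ('X_i * 'X_j)) ->
  forall p, (msize p <= 3)%N -> P p.
Proof.
move=> PD PZ P1 PX PXX p le_p3.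
have P0 : P 0 by rewrite -(mul0r 1) -mpolyC0; apply: PZ.
rewrite [p]mpolyE big_seq; elim/big_rec: _ => // m q m_p.
apply: PD; rewrite -mul_mpolyC; apply: PZ.
have {m_p} : (mdeg m < 3)%N by exact: leq_trans (msize_mdeg_lt m_p) le_p3.
have deg1 (d : 'X_{1..n}) : (0 < mdeg d)%N -> exists i e, d = (U_(i) + e)%MM.
  rewrite lt0n mdeg_eq0 => /eqP nz; apply: contra_notP nz => no; apply/mnmP => i.
  rewrite mnm0E; apply/eqP; rewrite -leqn0 leqNgt; apply/negP => di; apply: no.
  by exists i, (d - U_(i))%MM; rewrite addmC submK // lep1mP -lt0n.
case: (posnP (mdeg m)) => [/eqP|m_gt0]; first by rewrite mdeg_eq0 => /eqP-> _; rewrite mpolyX0.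
have [i [e ->]] := deg1 m m_gt0; rewrite mdegD mdeg1 add1n !ltnS => le_e1.
case: (posnP (mdeg e)) => [/eqP|e_gt0].
  by rewrite mdeg_eq0 => /eqP->; rewrite addm0.
have /mdeg1P[j /eqP->] : mdeg e == 1%N by rewrite eqn_leq le_e1.
by rewrite mpolyXD.
Qed.

Lemma fps_const_half (a : fps A) : fps_const n (2^-1 : R) * (a *+ 2) = a.
Proof.
have half2 : fps_const n (2^-1 : R) * 2 = 1.
  by rewrite -(rmorph_nat (@fps_const R n) 2) -rmorphM mulVf ?pnatr_eq0 ?rmorph1.
by rewrite -[a *+ 2]mulr_natl mulrA half2 mul1r.
Qed.

(** The second-order expansion is linear in p, so monomials of degree at most 2 suffice. For a
    product of two variables, the cross term of [dir2M] carries a factor 2 that cancels the 1/2. *)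
Lemma taylor2 (g : 'cV[fps A]_n) u : (forall i, g i 0 = C 'X_i + u i) ->
  forall p, (msize p <= 3)%N ->
  fps_subst g p = C p + dir1 u p + fps_const n 2^-1 * dir2 u p.
Proof.
move=> gE; apply: quadratic_mpoly_ind => [p q Pp Pq|c p Pp||i|i j].
- rewrite !rmorphD /= dir1D dir2D Pp Pq mulrDr.
  by rewrite [X in _ = X + _]addrACA [RHS]addrACA.
- rewrite !rmorphM /= dir1M dir2M dir1C dir2C fps_substC Pp !mul0r mul0rn !add0r.
  by rewrite /fps_const /= [X in _ = _ + X]mulrCA -!mulrDr.
- by rewrite -mpolyC1 fps_substC dir1C dir2C mulr0 !addr0.
- by rewrite fps_substX dir1X dir2X mulr0 addr0 gE.
- rewrite rmorphM /= dir1M dir2M !fps_substX !dir1X !dir2X !gE rmorphM /=.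
  rewrite mul0r mulr0 addr0 add0r fps_const_half mulrDl !mulrDr.
  by rewrite -!addrA; congr (_ + _); rewrite addrCA.
Qed.

End Kahan.

(** * The Kahan map and its Jacobian *)

Section KahanMap.
Variables (R : realType) (n : nat).
Local Notation A := {mpoly R[n]}.
Local Notation C := (@fpsC A).
Local Notation X := (fpsX A).
Local Notation field := 'cV[A]_n.
Implicit Types (f : field) (c : R) (N : nat).

Definition kahan_incr f : 'cV[fps A]_n := kahan f - map_mx C (\col_i 'X_i).

Lemma kahanE f i : kahan f i 0 = C 'X_i + kahan_incr f i 0.
Proof. by rewrite /kahan_incr; move: (kahan f) => g; rewrite !mxE [RHS]addrC subrK. Qed.

Definition shifted_jacobian f c : 'M[fps A]_n :=
  1%:M + (X * fps_const n c) *: map_mx C (jacobian f).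

Definition det_series f c : fps A := \det (shifted_jacobian f c).

Lemma det_series_unit f c : det_series f c \is a GRing.unit.
Proof.
apply: fps_unit1; rewrite -[LHS]/(fps_eval0 _) /det_series -det_map_mx.
rewrite (_ : map_mx _ _ = 1%:M) ?det1 //; apply/matrixP => i j.
rewrite !mxE rmorphD !rmorphM /= rmorph_nat /= [X in _ + X * _ * _](_ : _ = 0) //.
by rewrite !mul0r addr0.
Qed.

Lemma mulmx_shifted_jacobian f c m (M : 'M[fps A]_(n, m)) i j :
  (shifted_jacobian f c *m M) i j =
  M i j + X * fps_const n c * \sum_k C (f i 0)^`M(k) * M k j.
Proof.
rewrite /shifted_jacobian mulmxDl mul1mx -scalemxAl !mxE; congr (_ + _ * _).
by apply: eq_bigr => k _; rewrite !mxE.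
Qed.

Lemma shifted_jacobian_unitmx f c : shifted_jacobian f c \in unitmx.
Proof. by rewrite unitmxE; exact: det_series_unit. Qed.

Lemma kahan_incr_eq f :
  shifted_jacobian f (- 2^-1) *m kahan_incr f = X *: map_mx C f.
Proof.
rewrite /kahan_incr /kahan addrAC subrr add0r -scalemxAr; congr (_ *: _).
rewrite (_ : 1%:M - _ = shifted_jacobian f (- 2^-1)).
  by rewrite mulKVmx // shifted_jacobian_unitmx.
by rewrite /shifted_jacobian rmorphN mulrN scaleNr.
Qed.

(** Kahan's method in implicit form, u = h f + (h/2) f' u. The factor h in front of every term makes
    expansion in powers of h a terminating recursion for each coefficient. *)
Lemma kahan_incrE f i : kahan_incr f i 0 =
  X * C (f i 0) + X * (fps_const n 2^-1 * dir1 (fun j => kahan_incr f j 0) (f i 0)).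
Proof.
have : (shifted_jacobian f (- 2^-1) *m kahan_incr f) i 0 = X * C (f i 0).
  by rewrite kahan_incr_eq !mxE.
rewrite mulmx_shifted_jacobian rmorphN mulrN mulNr => /(canRL (subrK _)) ->.
congr (_ + _); rewrite -mulrA; congr (_ * (_ * _)).
by apply: eq_bigr => j _; rewrite mulrC.
Qed.

(** Differentiating u = h f + (h/2) f' u gives (1 - h f'/2) Du = h f' + (h/2) f'' u. With DPhi = 1 +
    Du the right side becomes 1 + (h/2)(f' + f'' u), and f' + f'' u = f'(x + u) because f' is
    affine. *)
Lemma fps_jacobian_kahan f : quadratic f ->
  shifted_jacobian f (- 2^-1) *m fps_jacobian (kahan f) =
  1%:M + (X * fps_const n 2^-1) *: map_mx (fps_subst (kahan f)) (jacobian f).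
Proof.
move=> qf; apply/matrixP => i j.
pose u i := kahan_incr f i 0; pose h2 := X * fps_const n 2^-1.
have Du k : fps_jacobian (kahan f) k j = (k == j)%:R + fps_deriv j (u k).
  rewrite mxE -/(fps_deriv j (kahan f k 0)) kahanE fps_derivD fps_derivC.
  by rewrite mderivU mpolyC_nat rmorph_nat.
pose J k : fps A := C (f i 0)^`M(k).
have derivU : fps_deriv j (u i) =
    X * J j + h2 * \sum_k (fps_deriv j (u k) * J k + u k * C (f i 0)^`M(j)^`M(k)).
  rewrite {1}/u kahan_incrE fps_derivD !fps_derivM fps_derivX mul0r add0r.
  rewrite !fps_derivC mderivC rmorph0 !mul0r !add0r mulrA fps_deriv_sum.
  congr (_ + _ * _); apply: eq_bigr => k _.
  by rewrite fps_derivM fps_derivC mderiv_comm.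
have substJ : fps_subst (kahan f) (f i 0)^`M(j) =
    J j + \sum_k u k * C (f i 0)^`M(j)^`M(k).
  have lt1 : (msize (f i 0%R)^`M(j) <= 2)%N by exact: msize_mderiv.
  apply: etrans (taylor2 (kahanE f) (leqW lt1)) _.
  (* The second-order Taylor term of f' contains third derivatives of f, which vanish. *)
  rewrite -[RHS]addr0; congr (_ + _).
  rewrite [dir2 _ _]big1 ?mulr0 // => k _; rewrite big1 ?mulr0 // => l _.
  have := msize_mderiv l (msize_mderiv k lt1).
  by rewrite leqn0 msize_poly_eq0 => /eqP->; rewrite rmorph0 mulr0.
(* Here d is the Kronecker delta, h stands for h/2, and a, b, c are the entries of f', f' Du and f''
   u. *)
have collect (B : comNzRingType) (d h a b c : B) :
    d + ((h + h) * a + h * (b + c)) - h * (a + b) = d + h * (a + c) by ring.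
have h2D : h2 + h2 = X by rewrite -[RHS]fps_const_half mulrnAr mulr2n /h2 [X * _]mulrC.
rewrite mulmx_shifted_jacobian rmorphN mulrN mulNr -/h2.
have -> : \sum_k C (f i 0)^`M(k) * fps_jacobian (kahan f) k j =
    J j + \sum_k fps_deriv j (u k) * J k.
  rewrite (eq_bigr (fun k => J k * (k == j)%:R + fps_deriv j (u k) * J k)).
    rewrite big_split /= (bigD1 j) //= eqxx mulr1 big1 ?addr0 // => k /negPf->.
    exact: mulr0.
  by move=> k _; rewrite Du mulrDr; congr (_ + _); exact: mulrC.
rewrite Du derivU big_split [RHS]mxE [X in _ = _ + X]mxE [X in _ = _ + _ * X]mxE.
rewrite [jacobian f i j]mxE substJ mxE -h2D; exact: collect.
Qed.

Lemma det_series_poly f c : det_series f c =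
  fps_of_poly (\det (1%:M + ('X * c%:MP%:P) *: map_mx polyC (jacobian f))).
Proof.
rewrite -det_map_mx; congr (\det _); apply/matrixP => i j.
rewrite !mxE rmorphD !rmorphM /= rmorph_nat.
by rewrite fps_of_polyX !fps_of_polyC.
Qed.

Lemma fps_comp_det_series f c g :
  fps_comp (det_series f c) g =
  \det (1%:M + (X * fps_const n c) *: map_mx (fps_subst g) (jacobian f)).
Proof.
rewrite det_series_poly fps_comp_poly -det_map_mx -horner_evalE -det_map_mx.
congr (\det _); apply/matrixP => i j; rewrite !mxE /horner_eval /=.
rewrite rmorphD !rmorphM /= rmorph_nat map_polyX !map_polyC /= fps_substC.
by rewrite /horner_eval -polyC_natr hornerD !hornerM hornerX !hornerC.
Qed.

Lemma det_jacobian_kahan f : quadratic f ->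
  det_series f (- 2^-1) * \det (fps_jacobian (kahan f)) =
  fps_comp (det_series f 2^-1) (kahan f).
Proof. by move=> qf; rewrite fps_comp_det_series -fps_jacobian_kahan // det_mulmx. Qed.

End KahanMap.

(** * Composition with the Kahan map *)

Lemma rmorph_net (B B' : comNzRingType) (phi : {rmorphism B -> B'}) n (X : finType)
    (K : X -> 'I_n -> 'X_{1..n} -> B) (g : X -> X) :
  phi (net K g) = net (fun v i m => phi (K v i m)) g.
Proof. by rewrite rmorph_sum; apply: eq_bigr => l _; rewrite rmorph_prod. Qed.

Section Composition.
Variables (R : realType) (n : nat).
Local Notation A := {mpoly R[n]}.
Local Notation C := (@fpsC A).
Local Notation X := (fpsX A).
Local Notation field := 'cV[A]_n.
Implicit Types (f : field) (N M k : nat).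

(* Some false: derivatives of f at x; Some true: derivatives of f at the image
   of x under the Kahan map; None: the displacement of x under that map, for
   vertices without predecessors. *)
Definition color_value f (c : option bool) (i : 'I_n) (m : 'X_{1..n}) : fps A :=
  match c with
  | Some false => C (field_jet f i m)
  | Some true => fps_subst (kahan f) (field_jet f i m)
  | None => kahan_incr f i 0
  end.

Definition color_net f (V : finType) (col : V -> option bool) (g : V -> V) : fps A :=
  net (fun v => color_value f (col v)) g.

(** Values of an ordinary vertex with one displacement leaf attached and, for [graft2], with two. *)
Definition graft1 f i m : fps A :=
  \sum_j kahan_incr f j 0 * C (field_jet f i (m + U_(j))%MM).

Definition graft2 f i m : fps A :=
  \sum_j kahan_incr f j 0 * graft1 f i (m + U_(j))%MM.

Lemma field_jetU f i m j : field_jet f i (m + U_(j))%MM = (field_jet f i m)^`M(j).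
Proof. by rewrite /field_jet mderivmDm mderivmU1m. Qed.

Lemma color_recolor f (V : finType) (col : V -> option bool) (g : V -> V) v c :
  color_net f (recolor col v c) g =
  net (recolor (fun u => color_value f (col u)) v (color_value f c)) g.
Proof. by apply: eq_net => [u i m|//]; rewrite /recolor; case: (u == v). Qed.

Lemma color_graft1 f (V : finType) (col : V -> option bool) (g : V -> V) v :
  color_net f (net_color (recolor col v (Some false)) None) (graft g v) =
  net (recolor (fun u => color_value f (col u)) v (graft1 f)) g.
Proof.
pose K := fun u => color_value f (recolor col v (Some false) u).
transitivity (net (net_color K (color_value f None)) (graft g v)).
  by apply: eq_net => // -[].
rewrite net_graft; apply: eq_net => [u i m|//]; rewrite /recolor /K /recolor.
by case: (u =P v) => // _; rewrite eqxx.
Qed.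

Lemma color_graft2 f (V : finType) (col : V -> option bool) (g : V -> V) v :
  color_net f (net_color (net_color (recolor col v (Some false)) None) None)
    (graft (graft g v) (Some v)) =
  net (recolor (fun u => color_value f (col u)) v (graft2 f)) g.
Proof.
pose K := recolor (fun u => color_value f (col u)) v (graft1 f).
transitivity (net (net_color K (color_value f None)) (graft g v)); last first.
  rewrite net_graft; apply: eq_net => [u i m|//]; rewrite /recolor /K /recolor.
  by case: (u =P v) => // _; rewrite eqxx.
pose K' u := color_value f (net_color (recolor col v (Some false)) None u).
transitivity (net (net_color K' (color_value f None)) (graft (graft g v) (Some v))).
  by apply: eq_net => // -[].
rewrite net_graft; apply: eq_net => // -[u|] i m //.
rewrite /recolor /K' /net_color /= (inj_eq Some_inj) /K /recolor.
by case: (u =P v) => // _; rewrite eqxx.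
Qed.

(** The second hypothesis says that displacement vertices have no predecessors. At such a leaf,
    [kahan_incrE] offers an ordinary vertex, bare or carrying one new leaf, times h. *)
Lemma color_net_leaf f (V : finType) (col : V -> option bool) (g : V -> V) v :
  col v = None -> (forall u, col (g u) != None) ->
  color_net f col g = X *
    (color_net f (recolor col v (Some false)) g + fps_const n 2^-1 *
     color_net f (net_color (recolor col v (Some false)) None) (graft g v)).
Proof.
move=> colv leaf; rewrite color_graft1 color_recolor mulrDr mulrA -net_recolorD.
apply: net_recolor => l.
have -> : in_labels g l v = 0%MM.
  by rewrite /in_labels big_pred0 // => u; apply: contraNF (leaf u) => /eqP->; rewrite colv.
rewrite colv /= kahan_incrE -mulrA /field_jet mderivm0m; congr (_ + _ * (_ * _)).
by apply: eq_bigr => j _; rewrite field_jetU /field_jet mderivm0m.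
Qed.

(** Taylor expansion at [v]: the vertex becomes ordinary and carries zero, one or two displacement
    leaves. *)
Lemma color_net_shift f (V : finType) (col : V -> option bool) (g : V -> V) v :
  quadratic f -> col v = Some true ->
  color_net f col g =
    color_net f (recolor col v (Some false)) g +
    color_net f (net_color (recolor col v (Some false)) None) (graft g v) +
    fps_const n 2^-1 *
    color_net f (net_color (net_color (recolor col v (Some false)) None) None)
      (graft (graft g v) (Some v)).
Proof.
move=> qf colv; rewrite color_graft1 color_graft2 color_recolor.
rewrite -addrA -[net _ g in X in _ + X]mul1r -net_recolorD -[RHS]mul1r mulrDr.
rewrite mul1r -[X in X + _]mul1r -net_recolorD; apply: net_recolor => l.
rewrite colv !mul1r addrA /= (taylor2 (kahanE f)); last exact: msize_mderivm.
congr (_ + _ + _ * _); first by apply: eq_bigr => j _; rewrite field_jetU.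
apply: eq_bigr => j _; congr (_ * _); apply: eq_bigr => k _.
by rewrite !field_jetU.
Qed.

Lemma color_net_plain f (V : finType) (col : V -> option bool) (g : V -> V) :
  (forall v, col v = Some false) -> color_net f col g = C (graph_fun g f).
Proof. by move=> pl; rewrite rmorph_net; apply: eq_net => // v i m; rewrite pl. Qed.

Lemma card_net_color (V : finType) (col : V -> option bool) (P : pred (option bool)) :
  ~~ P None -> #|[pred u | P (net_color col None u)]| = #|[pred v | P (col v)]|.
Proof.
move=> /negPf PN; rewrite -!sum1_card big_option inE /= PN add0n.
by apply: eq_bigl => u; rewrite !inE.
Qed.

Lemma card_recolor (V : finType) (col : V -> option bool) v c (P : pred (option bool)) :
  (P (col v) + #|[pred u | P (recolor col v c u)]| =
   P c + #|[pred u | P (col u)]|)%N.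
Proof.
rewrite (cardD1 v) [in RHS](cardD1 v) !inE /recolor eqxx addnCA; congr (_ + (_ + _))%N.
by apply: eq_card => u; rewrite !inE; case: (u == v).
Qed.

Lemma fcoef_fps_const c (p : fps A) N : fcoef (fps_const n c * p) N = c *: fcoef p N.
Proof. by rewrite fcoefCM mul_mpolyC. Qed.

(** Here k counts the shifted vertices and M those that are not leaves. Expanding a shifted vertex
    lowers k and keeps N and M; expanding a leaf trades one power of h for one more vertex in M.
    Both preserve M + N, so the induction exhausts k first and then N. *)
Lemma universal_color_net N k (V : finType) (col : V -> option bool) (g : V -> V) M :
  #|[pred v | col v == Some true]| = k -> #|[pred v | col v != None]| = M ->
  (forall u, col (g u) != None) ->
  universal (M + N) (fun f => fcoef (color_net f col g) N).
Proof.
pose U N k := forall (V : finType) (col : V -> option bool) (g : V -> V) M,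
  #|[pred v | col v == Some true]| = k -> #|[pred v | col v != None]| = M ->
  (forall u, col (g u) != None) ->
  universal (M + N) (fun f => fcoef (color_net f col g) N).
pose shifted := pred1 (Some true); pose solid := predC1 (None : option bool).
suff {V col g M} U_all : U N k by move: V col g M.
have solid_graft (V : finType) (col : V -> option bool) g v :
    (forall u, col (g u) != None) -> col v != None ->
    forall u, net_color col None (graft g v u) != None.
  by move=> leaf nv [].
have solid_recolor (V : finType) (col : V -> option bool) (g : V -> V) v :
    (forall u, col (g u) != None) ->
    forall u, recolor col v (Some false) (g u) != None.
  by move=> leaf u; rewrite /recolor; case: (g u == v).
have recolorv (V : finType) (col : V -> option bool) v :
  recolor col v (Some false) v != None by rewrite /recolor eqxx.
have shift_step N' k' : U N' k' -> U N' k'.+1.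
  move: N' k' => {N k} N k IH V col g M sh so leaf.
  have /card_gt0P[v /eqP colv] : (0 < #|[pred v | col v == Some true]|)%N by rewrite sh.
  have sh1 : #|[pred u | recolor col v (Some false) u == Some true]| = k.
    have := card_recolor col v (Some false) shifted.
    by rewrite colv => e; apply: succn_inj; exact: (etrans e sh).
  have so1 : #|[pred u | recolor col v (Some false) u != None]| = M.
    have := card_recolor col v (Some false) solid.
    by rewrite colv => e; apply: succn_inj; rewrite -so; exact: e.
  have sh2 (V' : finType) (col' : V' -> option bool) :
    #|[pred u | net_color col' None u == Some true]| = #|[pred u | col' u == Some true]|.
    exact: (card_net_color col' (P := shifted)).
  have so2 (V' : finType) (col' : V' -> option bool) :
    #|[pred u | net_color col' None u != None]| = #|[pred u | col' u != None]|.
    exact: (card_net_color col' (P := solid)).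
  have u1 := IH _ _ g M sh1 so1 (solid_recolor _ _ _ v leaf).
  have l2 := solid_graft _ _ _ v (solid_recolor _ _ _ v leaf) (recolorv _ _ _).
  have u2 := IH _ _ _ M (etrans (sh2 _ _) sh1) (etrans (so2 _ _) so1) l2.
  have l3 := solid_graft _ _ _ (Some v) l2 (recolorv _ _ _).
  have u3 := IH _ _ _ M (etrans (sh2 _ _) (etrans (sh2 _ _) sh1))
    (etrans (so2 _ _) (etrans (so2 _ _) so1)) l3.
  apply: eq_universal (universalD (universalD u1 u2) (universalZ 2^-1 u3)) => f qf.
  by rewrite (color_net_shift _ qf colv) fcoefD fcoefD fcoef_fps_const.
(* For N' = 0 the induction hypothesis is vacuous: the factor h produced by a leaf then makes the
   coefficient zero. *)
have leaf_step N' : (forall N1, N' = N1.+1 -> U N1 0%N) -> U N' 0%N.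
  move: N' => {N k} N IH V col g M sh so leaf.
  have [[v colv]|no_leaf] := pselect (exists v, col v = None); last first.
    have plain v : col v = Some false.
      case colv: (col v) => [[]|] //; last by case: no_leaf; exists v.
      by have /card0_eq/(_ v) := sh; rewrite !inE colv eqxx.
    have cardV : #|V| = M by rewrite -so; apply: eq_card => v; rewrite !inE plain.
    (* All vertices are ordinary here, so the net is constant in h. *)
    case: N {IH} => [|N].
      rewrite addn0; apply: eq_universal (universal_graph _ _ g cardV) => f _.
      by rewrite color_net_plain.
    by apply: eq_universal (universal0 _ _ _) => f _; rewrite color_net_plain.
  have sh1 : #|[pred u | recolor col v (Some false) u == Some true]| = 0%N.
    have := card_recolor col v (Some false) shifted.
    by rewrite colv => e; exact: (etrans e sh).
  have so1 : #|[pred u | recolor col v (Some false) u != None]| = M.+1.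
    have := card_recolor col v (Some false) solid.
    by rewrite colv => e; rewrite -so; exact: e.
  have sh2 : #|[pred u | net_color (recolor col v (Some false)) None u == Some true]| = 0%N.
    by rewrite (card_net_color _ (P := shifted)).
  have so2 : #|[pred u | net_color (recolor col v (Some false)) None u != None]| = M.+1.
    by rewrite (card_net_color _ (P := solid)).
  case: N IH => [_|N /(_ N erefl) IH].
    apply: eq_universal (universal0 _ _ _) => f _.
    by rewrite (color_net_leaf f colv leaf) fcoefXM.
  have u1 := IH _ _ g _ sh1 so1 (solid_recolor _ _ _ v leaf).
  have u2 := IH _ _ _ _ sh2 so2 (solid_graft _ _ _ v
    (solid_recolor _ _ _ v leaf) (recolorv _ _ _)).
  rewrite addnS -addSn.
  apply: eq_universal (universalD u1 (universalZ 2^-1 u2)) => f qf.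
  by rewrite (color_net_leaf f colv leaf) fcoefXM fcoefD fcoef_fps_const.
have U0 : forall N, U N 0%N.
  by elim=> [|N' IH]; apply: leaf_step => // _ [<-].
by elim: k => [|k]; [exact: U0 | exact: shift_step].
Qed.

(** A graph with k vertices in the h^k coefficient of P becomes a net with all k vertices shifted;
    its h^(N-k) coefficient is universal of degree k + (N-k) = N. *)
Lemma universal_comp_kahan (P : field -> fps A) :
  universal_series P -> universal_series (fun f => fps_comp (P f) (kahan f)).
Proof.
move=> uP N; apply: (@universal_sum _ _ _ _ _ _ (fun (k : 'I_N.+1) f =>
  fcoef (fps_subst (kahan f) (fcoef (P f) k)) (N - k))) => k _.
have [c cP] := uP k.
have ug (g : {ffun 'I_k -> 'I_k}) :
    universal N (fun f => c g *: fcoef (fps_subst (kahan f) (graph_fun g f)) (N - k)).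
  apply: universalZ; rewrite -{1}(subnKC (leq_ord k)).
  have := @universal_color_net (N - k) _ _ (fun=> Some true) g k erefl.
  move=> /(_ _ (fun=> isT)) u; apply: eq_universal (u _) => [f _|].
    by rewrite rmorph_net.
  by rewrite -[RHS]card_ord; apply: eq_card.
apply: eq_universal (universal_sum (index_enum _) (P := xpredT) (fun g _ => ug g)) => f qf.
rewrite cP // raddf_sum fcoef_sum; apply: eq_bigr => g _.
by rewrite -fcoef_fps_const -fps_substZ.
Qed.

End Composition.

(** * The determinant of 1 + c h f' *)

Section Jacobi.
Variables (B : comNzRingType).

Lemma deriv_prod (I : eqType) (r : seq I) (F : I -> {poly B}) : uniq r ->
  (\prod_(i <- r) F i)^`() =
  \sum_(i <- r) (F i)^`() * \prod_(j <- r | j != i) F j.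
Proof.
elim: r => [|i r IHr] /=; first by rewrite !big_nil derivC.
case/andP=> i_r /IHr {}IHr; rewrite !big_cons eqxx derivM IHr big_distrr /=.
congr (_ * _ + _).
  rewrite [RHS]big_seq_cond [LHS]big_seq; apply: eq_bigl => j.
  by case: eqP => [->|]; rewrite ?(negPf i_r) ?andbT.
rewrite !big_seq; apply: eq_bigr => j j_r; rewrite big_cons ifT ?(mulrCA (F i)) //.
by apply: contraNneq i_r => ->.
Qed.

(** Jacobi's formula: by the product rule the derivative is the sum of the determinants with one row
    differentiated, each then expanded along that row. *)
Lemma deriv_det n (M : 'M[{poly B}]_n) :
  (\det M)^`() = \tr (map_mx (@deriv B) M *m \adj M).
Proof.
pose D i : 'M[{poly B}]_n := \matrix_(x, y) (if x == i then (M i y)^`() else M x y).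
transitivity (\sum_i \det (D i)); last first.
  apply: eq_bigr => i _; rewrite mxE (expand_det_row _ i); apply: eq_bigr => k _.
  rewrite !mxE eqxx /cofactor; congr (_ * (_ * \det _)).
  by apply/matrixP => x y; rewrite !mxE eq_sym (negPf (neq_lift _ _)).
rewrite /determinant raddf_sum exchange_big; apply: eq_bigr => s _ /=.
rewrite -signr_odd derivM -polyC1 -polyCN -polyC_exp derivC mul0r add0r -big_distrr /=.
congr (_ * _); rewrite deriv_prod ?index_enum_uniq //; apply: eq_bigr => i _.
rewrite [RHS](bigD1 i) //= mxE eqxx; congr (_ * _).
by apply: eq_bigr => j /negPf ne; rewrite mxE ne.
Qed.

Variables (n : nat) (a : B) (A : 'M[B]_n).

Definition det_pencil : {poly B} := \det (1%:M + ('X * a%:P) *: map_mx polyC A).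

Definition mxpower k : 'M[B]_n := iter k (mulmx A) 1%:M.

(** Auxiliary unknowns tr(A^k adj(1 + a X A)): Jacobi's formula brings in the case k = 1, and the
    recursion below closes on the whole family. *)
Definition adj_trace k : {poly B} :=
  \tr (map_mx polyC (mxpower k) *m \adj (1%:M + ('X * a%:P) *: map_mx polyC A)).

Lemma coef0_det_pencil : det_pencil`_0 = 1.
Proof.
rewrite -horner_coef0 -horner_evalE -det_map_mx.
rewrite (_ : map_mx _ _ = 1%:M) ?det1 //; apply/matrixP => i j.
by rewrite !mxE /= /horner_eval -polyC_natr hornerD !hornerM hornerX !hornerC !mul0r addr0.
Qed.

(** Jacobi's formula read coefficientwise, without dividing by N+1 since B is an arbitrary
    commutative ring. *)
Lemma coefS_det_pencil N : det_pencil`_N.+1 *+ N.+1 = a * (adj_trace 1)`_N.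
Proof.
rewrite -coef_deriv deriv_det -coefCM /adj_trace /mxpower /= mulmx1.
rewrite -[a%:P * _]mxtraceZ scalemxAl; rewrite (_ : map_mx _ _ = a%:P *: map_mx polyC A) //.
apply/matrixP => i j; rewrite !mxE -polyC_natr !derivE.
by rewrite !mulr0 !addr0 add0r mul1r.
Qed.

(** With M = 1 + a X A, the identity adj(M) M = det M reads adj(M) = det M - a X adj(M) A; multiply
    by A^k and take the trace. *)
Lemma adj_traceS k :
  adj_trace k = (\tr (mxpower k))%:P * det_pencil - 'X * a%:P * adj_trace k.+1.
Proof.
apply/eqP; rewrite eq_sym subr_eq eq_sym; apply/eqP.
set M := 1%:M + ('X * a%:P) *: map_mx polyC A.
have -> : adj_trace k.+1 = \tr (map_mx polyC (mxpower k) *m (\adj M *m map_mx polyC A)).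
  by rewrite /adj_trace /= map_mxM -mulmxA mxtrace_mulC -mulmxA.
rewrite -mxtraceZ -mxtraceD scalemxAr -mulmxDr.
have -> : \adj M + ('X * a%:P) *: (\adj M *m map_mx polyC A) = \adj M *m M.
  by rewrite [in RHS]/M mulmxDr mulmx1 -scalemxAr.
rewrite mul_adj_mx mul_mx_scalar mxtraceZ mulrC; congr (_ * _).
by rewrite /mxtrace raddf_sum; apply: eq_bigr => i _; rewrite mxE.
Qed.

End Jacobi.

(** * Universality of traces of powers of f' and of det(1 + c h f') *)

Section DetSeries.
Variables (R : realType) (n : nat).
Local Notation A := {mpoly R[n]}.
Local Notation field := 'cV[A]_n.
Implicit Types (f : field) (c : R) (N k : nat).

(** A chain of k+1 ordinary vertices seen as a single one: the bottom vertex has label i and the top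
    one receives the predecessors m. *)
Fixpoint power_jet f k (i : 'I_n) (m : 'X_{1..n}) : A :=
  if k is k'.+1 then \sum_j power_jet f k' j m * field_jet f i U_(j)%MM
  else field_jet f i m.

Lemma power_jetE f k i j : power_jet f k i U_(j)%MM = mxpower (jacobian f) k.+1 i j.
Proof.
elim: k i => [|k IHk] i /=; first by rewrite /field_jet mderivmU1m mulmx1 mxE.
rewrite mxE; apply: eq_bigr => l _.
by rewrite mulrC IHk /field_jet mderivmU1m [jacobian f i l]mxE.
Qed.

Lemma universal_power_jet k (V : finType) v (g : V -> V) M : #|V| = M ->
  universal (M + k) (fun f =>
    net (recolor (fun _ => field_jet f) v (power_jet f k)) g).
Proof.
elim: k V v g M => [|k IHk] V v g M cardV.
  rewrite addn0; apply: eq_universal (universal_graph _ _ g cardV) => f _.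
  by apply: eq_net => [u i m|//]; rewrite /recolor; case: (u == v).
have cardV1 : #|{: option V}| = M.+1 by rewrite card_option cardV.
rewrite addnS -addSn; apply: eq_universal (IHk _ None (insert g v) _ cardV1) => f _.
by rewrite -net_insert; apply: eq_net => // -[].
Qed.

(** A self-loop whose only vertex stands for a chain of k+1 vertices is a cycle of length k+1. *)
Lemma universal_trace_power k : universal k.+1 (fun f => \tr (mxpower (jacobian f) k.+1)).
Proof.
apply: eq_universal (universal_power_jet k tt id card_unit) => f _.
rewrite /net (reindex (fun i : 'I_n => [ffun _ : unit => i])) /=; last first.
  exists (fun l : {ffun unit -> 'I_n} => l tt) => [i _|l _]; first by rewrite ffunE.
  by apply/ffunP => -[]; rewrite ffunE.
apply: eq_bigr => i _; rewrite (big_pred1 tt) => [|[] //].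
rewrite /recolor eqxx ffunE /in_labels (big_pred1 tt) => [|[] //].
by rewrite ffunE power_jetE.
Qed.

(** Joint induction on N: Jacobi's formula gives the determinant at N+1 from [adj_trace] at N, and
    [adj_traceS] then gives every [adj_trace] at N+1 from that coefficient, the traces, and
    [adj_trace] at N. *)
Lemma universal_det_pencil c N :
  universal N (fun f => (det_pencil c%:MP (jacobian f))`_N) /\
  forall k, universal (N + k.+1) (fun f => (adj_trace c%:MP (jacobian f) k.+1)`_N).
Proof.
have traceE f k N' : (adj_trace c%:MP (jacobian f) k)`_N' =
    (det_pencil c%:MP (jacobian f))`_N' * \tr (mxpower (jacobian f) k) -
    c *: (if N' is N1.+1 then (adj_trace c%:MP (jacobian f) k.+1)`_N1 else 0).
  rewrite adj_traceS coefB coefCM mulrC -mulrA coefXM; congr (_ - _).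
  by case: N' => [|N1]; rewrite ?scaler0 // coefCM mul_mpolyC.
elim: N => [|N [IHq IHt]].
  (* The constant 1 is the aromatic function of the empty graph. *)
  have u0 : universal 0 (fun f => (det_pencil c%:MP (jacobian f))`_0).
    apply: eq_universal (universal_graph R n (id : 'I_0 -> 'I_0) (card_ord 0)) => f _.
    rewrite coef0_det_pencil /graph_fun /net.
    rewrite (eq_bigr (fun=> 1)) => [|l _]; last by rewrite big_ord0.
    by rewrite sumr_const card_ffun !card_ord expn0.
  split=> // k.
  apply: eq_universal (universalM u0 (universal_trace_power k)) => f _.
  by rewrite traceE scaler0 subr0.
have uS : universal N.+1 (fun f => (det_pencil c%:MP (jacobian f))`_N.+1).
  have := universalZ (c / N.+1%:R) (IHt 0%N); rewrite addn1.
  apply: eq_universal => f _.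
  rewrite [c / _]mulrC -scalerA -[c *: _]mul_mpolyC -coefS_det_pencil.
  by rewrite -scaler_nat scalerA mulVf ?scale1r // pnatr_eq0.
split=> // k.
have uk := universalM uS (universal_trace_power k).
have uk1 := universalZ (- c) (IHt k.+1); rewrite addnS -addSn in uk1.
apply: eq_universal (universalD uk uk1) => f _.
by apply: etrans (traceE f k.+1 N.+1) _; rewrite scaleNr.
Qed.

Lemma universal_det_series c : universal_series (fun f => det_series f c).
Proof.
move=> N; apply: eq_universal (universal_det_pencil c N).1 => f _.
by rewrite det_series_poly.
Qed.

End DetSeries.

(* By det_jacobian_kahan the condition is equivalent to its product with the unit
   det(1 - h f'/2), which contains no Jacobian determinant. *)
Lemma preserves_measureE (R : realType) n (f : 'cV[{mpoly R[n]}]_n) P : quadratic f ->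
  fps_comp P (kahan f) = \det (fps_jacobian (kahan f)) * P <->
  det_series f (- 2^-1) * fps_comp P (kahan f)
    - fps_comp (det_series f 2^-1) (kahan f) * P = 0.
Proof.
move=> qf; rewrite -det_jacobian_kahan // -mulrA -mulrBr.
split=> [->|e]; first by rewrite subrr mulr0.
apply/eqP; rewrite -subr_eq0; apply/eqP.
by apply: (mulrI (det_series_unit f (- 2^-1))); rewrite e mulr0.
Qed.

Theorem mainTheorem2 (R : realType) (n : nat) (f ft : 'cV[{mpoly R[n]}]_n)
    (f_quad : quadratic f) (ft_quad : quadratic ft)
    (eq_ker : kerF f = kerF ft) :
  (forall gamma : aroma_dual R,
     preserves_measure (kahan f) (aromatic_series f gamma) <->
     preserves_measure (kahan ft) (aromatic_series ft gamma)) /\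
  (forall gamma delta : aroma_dual R,
     first_integral (kahan f)
       (aromatic_series f gamma) (aromatic_series f delta) <->
     first_integral (kahan ft)
       (aromatic_series ft gamma) (aromatic_series ft delta)).
Proof.
have transfer S : universal_series S -> S f = 0 <-> S ft = 0.
  by move=> uS; exact: universal_eq0.
have u (gamma : aroma_dual R) := aromatic_series_universal n gamma.
have uc gamma := universal_comp_kahan (u gamma).
have udet c := @universal_det_series R n c.
(* Both predicates join a nonvanishing condition to an equation; each part is transferred separately
   as the vanishing of a universal series. *)
have not_and (P P' Q Q' : Prop) : (P <-> P') -> (Q <-> Q') -> ~ P /\ Q <-> ~ P' /\ Q'.
  by tauto.
split=> [gamma|gamma delta]; apply: not_and.
- exact: transfer (u gamma).
- have uS := universal_seriesB (universal_seriesM (udet (- 2^-1)) (uc gamma))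
    (universal_seriesM (universal_comp_kahan (udet 2^-1)) (u gamma)).
  apply: iff_trans (preserves_measureE _ f_quad) _.
  exact: iff_trans (transfer _ uS) (iff_sym (preserves_measureE _ ft_quad)).
- exact: transfer (u delta).
have uS := universal_seriesB (universal_seriesM (uc gamma) (u delta))
  (universal_seriesM (u gamma) (uc delta)).
have subE (a b : fps {mpoly R[n]}) : a = b <-> a - b = 0.
  by split=> [->|/subr0_eq//]; rewrite subrr.
apply: iff_trans (subE _ _) _.
exact: iff_trans (transfer _ uS) (iff_sym (subE _ _)).
Qed.
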